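(* Let $\alpha\in[0,1)$ and let $h(z)=z+a_2z^2+\cdots$ be analytic in $\mathbb{D}=\{|z|<1\}$ and convex of order $\alpha$. Let $u(z)=h(z)+\frac{1}{2}(1-|z|^{2})\,zh'(z)$ for $z\in\mathbb{D}$. Then $u$ is univalent in $\mathbb{D}$ if $\alpha\ge 1/2$, and if $\alpha\in[0,1/2)$ then $u$ is univalent in the subdisk $|z|<r$, where $$r=\frac{-(1-\alpha)+\sqrt{(1-\alpha)^2+1-2\alpha}}{1-2\alpha}.$$
   Context: For $\alpha\in[-1/2,1)$, a locally univalent analytic function $h(z)=z+a_2z^2+\cdots$ in $\mathbb{D}$ is convex of order $\alpha$ if $\operatorname{Re}\big(1+zh''(z)/h'(z)\big)>\alpha$ for all $z\in\mathbb{D}$. *)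

(* Defs.v *)
From Stdlib Require Import Reals.
From Coquelicot Require Import Coquelicot.

Open Scope R_scope.

Definition in_disk (r : R) (z : C) : Prop := Cmod z < r.
Definition unit_disk (z : C) : Prop := in_disk 1 z.

Definition has_cderiv_on_disk (f f' : C -> C) : Prop :=
  forall z : C, unit_disk z -> is_derive (K := C_AbsRing) (V := C_NormedModule) f z (f' z).

(* h analytic in D, normalized h(z) = z + a_2 z^2 + ..., i.e. h(0) = 0 and h'(0) = 1,
   with first and second derivatives h1, h2 on D. *)
Definition normalized_analytic (h h1 h2 : C -> C) : Prop :=
  has_cderiv_on_disk h h1 /\ has_cderiv_on_disk h1 h2 /\
  h (RtoC 0) = RtoC 0 /\ h1 (RtoC 0) = RtoC 1.

Definition convex_of_order (alpha : R) (h1 h2 : C -> C) : Prop :=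
  (forall z : C, unit_disk z -> h1 z <> RtoC 0) /\
  (forall z : C, unit_disk z ->
     Re (Cplus (RtoC 1) (Cdiv (Cmult z (h2 z)) (h1 z))) > alpha).

Definition u_of (h h1 : C -> C) (z : C) : C :=
  Cplus (h z) (Cmult (RtoC ((1 / 2) * (1 - (Cmod z) ^ 2))) (Cmult z (h1 z))).

Definition univalent_on (S : C -> Prop) (f : C -> C) : Prop :=
  forall z w : C, S z -> S w -> f z = f w -> z = w.

Definition radius_r (alpha : R) : R :=
  (- (1 - alpha) + sqrt ((1 - alpha) ^ 2 + 1 - 2 * alpha)) / (1 - 2 * alpha).

(* Main.v *)
Require Import Defs.
From Stdlib Require Import Reals Lra Lia Classical ClassicalEpsilon.
From Coquelicot Require Import Coquelicot.
Open Scope R_scope.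

(** Injectivity holds on the whole unit disk as soon as [alpha >= 0], and
    [radius_r alpha <= 1].  Let [c = h z1 - h z0].  The segment from [h z0] to [h z1]
    lifts through [h] to a path [g] in the disk.  Put [phi = |g|^2] and
    [psi = Re (conj c * g * h1 g)].  Since [g' = c / h1 g], one finds
    [phi' = 2 psi / |h1 g|^2] and [psi' = |c|^2 Re (1 + g h2 g / h1 g) > 0].  Hence
    [phi'] changes sign at most once, from negative to positive, so [|g|] never exceeds
    the larger of its end values; this a priori bound is what allows the lift to be
    continued while its end point moves along the segment from [z0] to [z1].  Finally
    [Re (conj c * u g) = const + |c|^2 t + (1 - phi) psi / 2] has derivative at least
    [|c|^2 (1 - phi) (1 + psi' / (2 |c|^2)) > 0], because
    [psi^2 <= |c|^2 phi |h1 g|^2]; therefore [u z0 <> u z1].  When [c = 0] the lift is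
    constant and [z0 = z1]. *)

(** * Complex and path derivatives in epsilon-delta form *)

(** Clearing the difference quotient of its denominator lets [w = z] in, so estimates need no case
    split. *)
Definition Cderiv (f : C -> C) (z l : C) : Prop :=
  forall eps, 0 < eps -> exists del, 0 < del /\ forall w,
    Cmod (w - z)%C < del -> Cmod (f w - f z - l * (w - z))%C <= eps * Cmod (w - z)%C.

Definition Rderiv (g : R -> C) (t : R) (l : C) : Prop :=
  forall eps, 0 < eps -> exists del, 0 < del /\ forall s,
    Rabs (s - t) < del ->
    Cmod (g s - g t - RtoC (s - t) * l)%C <= eps * Rabs (s - t).

Definition Rcont (g : R -> C) (t : R) : Prop :=
  forall eps, 0 < eps -> exists del, 0 < del /\ forall s,
    Rabs (s - t) < del -> Cmod (g s - g t)%C < eps.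

Lemma is_derive_Cderiv (f : C -> C) (z l : C) :
  is_derive (K := C_AbsRing) (V := C_NormedModule) f z l -> Cderiv f z l.
Proof.
intros [_ H] eps Heps.
destruct (H z (fun P HP => HP) (mkposreal eps Heps)) as [d Hd].
exists d; split; [apply cond_pos|].
intros w Hw.
generalize (Hd w Hw); intros E.
replace (f w - f z - l * (w - z))%C with (f w - f z - (w - z) * l)%C by ring.
exact E.
Qed.

Lemma Cmod_sub_sym (z w : C) : Cmod (z - w)%C = Cmod (w - z)%C.
Proof. rewrite <- Cmod_opp; f_equal; ring. Qed.

Lemma Cmod_sub_triangle (x y z : C) : Cmod (x - z)%C <= Cmod (x - y)%C + Cmod (y - z)%C.
Proof.
replace (x - z)%C with ((x - y) + (y - z))%C by ring; apply Cmod_triangle.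
Qed.

Lemma Cmod_le_add_sub (x y : C) : Cmod x <= Cmod y + Cmod (x - y)%C.
Proof.
replace x with (y + (x - y))%C at 1 by ring; apply Cmod_triangle.
Qed.

Lemma Im_le_Cmod (z : C) : Rabs (Im z) <= Cmod z.
Proof. eapply Rle_trans; [apply Rmax_r | apply Rmax_Cmod]. Qed.

Lemma Cmod_le_Re_Im (z : C) : Cmod z <= Rabs (Re z) + Rabs (Im z).
Proof.
replace z with (RtoC (Re z) + Ci * RtoC (Im z))%C at 1.
- eapply Rle_trans; [apply Cmod_triangle|].
  rewrite Cmod_mult, !Cmod_R, Cmod_Ci; lra.
- destruct z as [x y]; unfold Ci, RtoC, Cplus, Cmult; simpl; f_equal; ring.
Qed.

Lemma Cderiv_bound (f : C -> C) (z l : C) :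
  Cderiv f z l -> exists del, 0 < del /\ forall w,
    Cmod (w - z)%C < del -> Cmod (f w - f z)%C <= (Cmod l + 1) * Cmod (w - z)%C.
Proof.
intros H; destruct (H 1 Rlt_0_1) as [d [Hd K]].
exists d; split; [exact Hd|]; intros w Hw.
pose proof (Cmod_le_add_sub (f w - f z) (l * (w - z))) as T.
rewrite Cmod_mult in T; specialize (K w Hw); lra.
Qed.

Lemma Cderiv_cont (f : C -> C) (z l : C) :
  Cderiv f z l -> forall eps, 0 < eps -> exists del, 0 < del /\ forall w,
    Cmod (w - z)%C < del -> Cmod (f w - f z)%C < eps.
Proof.
intros H eps Heps.
destruct (Cderiv_bound f z l H) as [d [Hd K]].
pose proof (Cmod_ge_0 l) as Hl.
assert (Hq : 0 < eps / (Cmod l + 1)) by (apply Rdiv_lt_0_compat; lra).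
exists (Rmin d (eps / (Cmod l + 1))); split; [now apply Rmin_glb_lt|].
intros w Hw.
pose proof (Rmin_l d (eps / (Cmod l + 1))).
pose proof (Rmin_r d (eps / (Cmod l + 1))).
apply Rle_lt_trans with ((Cmod l + 1) * Cmod (w - z)%C); [apply K; lra|].
apply Rlt_le_trans with ((Cmod l + 1) * (eps / (Cmod l + 1))).
- apply Rmult_lt_compat_l; lra.
- right; field; lra.
Qed.

Lemma Rderiv_Rcont (g : R -> C) (t : R) (l : C) : Rderiv g t l -> Rcont g t.
Proof.
intros H eps Heps; destruct (H 1 Rlt_0_1) as [d [Hd K]].
pose proof (Cmod_ge_0 l) as Hl.
assert (Hq : 0 < eps / (Cmod l + 1)) by (apply Rdiv_lt_0_compat; lra).
exists (Rmin d (eps / (Cmod l + 1))); split; [now apply Rmin_glb_lt|].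
intros s Hs.
pose proof (Rmin_l d (eps / (Cmod l + 1))).
pose proof (Rmin_r d (eps / (Cmod l + 1))).
pose proof (Cmod_le_add_sub (g s - g t) (RtoC (s - t) * l)) as T.
rewrite Cmod_mult, Cmod_R in T; specialize (K s ltac:(lra)).
apply Rle_lt_trans with ((Cmod l + 1) * Rabs (s - t)); [lra|].
apply Rlt_le_trans with ((Cmod l + 1) * (eps / (Cmod l + 1))).
- apply Rmult_lt_compat_l; lra.
- right; field; lra.
Qed.

Lemma Rcont_comp (f : C -> C) (g : R -> C) (t : R) (k : C) :
  Rcont g t -> Cderiv f (g t) k -> Rcont (fun s => f (g s)) t.
Proof.
intros Hg Hf eps Heps.
destruct (Cderiv_cont f (g t) k Hf eps Heps) as [d [Hd K]].
destruct (Hg d Hd) as [e [He L]].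
exists e; split; [exact He|]; intros s Hs; apply K, L, Hs.
Qed.

Lemma Rderiv_comp (f : C -> C) (g : R -> C) (t : R) (k l : C) :
  Rderiv g t l -> Cderiv f (g t) k -> Rderiv (fun s => f (g s)) t (k * l)%C.
Proof.
intros Hg Hf eps Heps.
pose proof (Cmod_ge_0 l) as Hl; pose proof (Cmod_ge_0 k) as Hk.
(* Each of the two error terms gets half of [eps]; the cap [e2 <= 1] also gives
   [|g s - g t| <= (|l| + 1) |s - t|]. *)
set (e1 := eps / 2 / (Cmod l + 1)).
set (e2 := Rmin 1 (eps / 2 / (Cmod k + 1))).
assert (He1 : 0 < e1) by (unfold e1; apply Rdiv_lt_0_compat; lra).
assert (He2 : 0 < e2)
  by (unfold e2; apply Rmin_glb_lt; [lra | apply Rdiv_lt_0_compat; lra]).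
destruct (Hf e1 He1) as [d1 [Hd1 K1]].
destruct (Hg e2 He2) as [d2 [Hd2 K2]].
destruct (Rderiv_Rcont g t l Hg d1 Hd1) as [d3 [Hd3 K3]].
exists (Rmin d2 d3); split; [now apply Rmin_glb_lt|].
intros s Hs.
pose proof (Rmin_l d2 d3); pose proof (Rmin_r d2 d3).
specialize (K2 s ltac:(lra)); specialize (K3 s ltac:(lra)); specialize (K1 (g s) K3).
replace (f (g s) - f (g t) - RtoC (s - t) * (k * l))%C
  with ((f (g s) - f (g t) - k * (g s - g t)) + k * (g s - g t - RtoC (s - t) * l))%C
  by ring.
eapply Rle_trans; [apply Cmod_triangle|]; rewrite Cmod_mult.
pose proof (Rabs_pos (s - t)) as Ha.
pose proof (Cmod_le_add_sub (g s - g t) (RtoC (s - t) * l)) as T.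
rewrite Cmod_mult, Cmod_R in T.
assert (E2 : e2 <= 1) by apply Rmin_l.
assert (E2' : e2 <= eps / 2 / (Cmod k + 1)) by apply Rmin_r.
assert (A : e1 * Cmod (g s - g t)%C <= eps / 2 * Rabs (s - t)).
{ apply Rle_trans with (e1 * ((Cmod l + 1) * Rabs (s - t))).
  - apply Rmult_le_compat_l; nra.
  - right; unfold e1; field; lra. }
assert (B : Cmod k * Cmod (g s - g t - RtoC (s - t) * l)%C <= eps / 2 * Rabs (s - t)).
{ apply Rle_trans with ((Cmod k + 1) * (eps / 2 / (Cmod k + 1) * Rabs (s - t))).
  - apply Rmult_le_compat; try lra; [apply Cmod_ge_0|].
    apply Rle_trans with (e2 * Rabs (s - t)); [lra|].
    now apply Rmult_le_compat_r.
  - right; field; lra. }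
lra.
Qed.

(** Differentiates a continuous local inverse along a line. With [D = g s - g t], the remainder of
    [f] is [-k (D - (s - t) c / k)]. A first crude use of its smallness gives
    [|D| <= 2 |s - t| |c| / |k|], and inserting this bound gives the derivative. *)
Lemma Rderiv_lift (f : C -> C) (g : R -> C) (t r : R) (c k : C) :
  Rcont g t -> Cderiv f (g t) k -> k <> RtoC 0 -> 0 < r ->
  (forall s, Rabs (s - t) < r -> f (g s) = (f (g t) + RtoC (s - t) * c)%C) ->
  Rderiv g t (c / k)%C.
Proof.
intros Hg Hf Hk Hr Heq eps Heps.
assert (Hk' : 0 < Cmod k) by now apply Cmod_gt_0.
pose proof (Cmod_ge_0 c) as Hc.
(* Chosen so that [(1 / b) * 2 (|c| + 1) / |k| = |k|]; the [+ 1] keeps [b] positive when [c = 0]. *)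
set (b := 2 * (Cmod c + 1) / (Cmod k * Cmod k)).
assert (Hb : 0 < b) by (unfold b; apply Rdiv_lt_0_compat; nra).
set (e := Rmin (Cmod k / 2) (eps / b)).
assert (He : 0 < e)
  by (unfold e; apply Rmin_glb_lt; [lra | now apply Rdiv_lt_0_compat]).
destruct (Hf e He) as [d1 [Hd1 K1]].
destruct (Hg d1 Hd1) as [d2 [Hd2 K2]].
exists (Rmin r d2); split; [now apply Rmin_glb_lt|].
intros s Hs.
pose proof (Rmin_l r d2); pose proof (Rmin_r r d2).
specialize (K1 (g s) (K2 s ltac:(lra))).
rewrite (Heq s) in K1 by lra.
set (D := (g s - g t)%C) in *.
replace (f (g t) + RtoC (s - t) * c - f (g t) - k * D)%C
  with (- (k * (D - RtoC (s - t) * (c / k))))%C in K1 by (field; exact Hk).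
rewrite Cmod_opp, Cmod_mult in K1.
pose proof (Rabs_pos (s - t)) as Ha.
assert (E1 : e <= Cmod k / 2) by apply Rmin_l.
assert (E2 : e <= eps / b) by apply Rmin_r.
pose proof (Cmod_ge_0 D) as HD.
pose proof (Cmod_le_add_sub D (RtoC (s - t) * (c / k))) as T.
rewrite Cmod_mult, Cmod_R, Cmod_div in T by exact Hk.
set (X := Cmod (D - RtoC (s - t) * (c / k))%C) in *.
assert (HX : X <= Cmod D / 2).
{ apply Rmult_le_reg_l with (Cmod k); nra. }
assert (HD2 : Cmod D <= 2 * Rabs (s - t) * (Cmod c / Cmod k)) by lra.
apply Rmult_le_reg_l with (Cmod k); [exact Hk'|].
eapply Rle_trans; [exact K1|].
apply Rle_trans with (eps / b * (2 * Rabs (s - t) * ((Cmod c + 1) / Cmod k))).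
- apply Rmult_le_compat; try lra.
  eapply Rle_trans; [exact HD2|].
  apply Rmult_le_compat_l; [lra|].
  apply Rmult_le_compat_r; [left; now apply Rinv_0_lt_compat | lra].
- right; unfold b; field; split; lra.
Qed.

(** * Real coordinates and mean value estimates *)

Lemma Rderiv_Re (g : R -> C) (t : R) (l : C) :
  Rderiv g t l -> is_derive (fun s => Re (g s)) t (Re l).
Proof.
intros H; apply is_derive_Reals; intros eps Heps.
destruct (H (eps / 2) ltac:(lra)) as [d [Hd K]].
exists (mkposreal d Hd); simpl; intros s Hs0 Hs.
specialize (K (t + s)).
replace (t + s - t) with s in K by ring; specialize (K Hs).
pose proof (Rle_trans _ _ _ (re_le_Cmod _) K) as B.
replace (Re (g (t + s)%R - g t - RtoC s * l)%C)
  with (s * ((Re (g (t + s)%R) - Re (g t)) / s - Re l)) in B.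
2:{ unfold Re, RtoC, Cminus, Cmult, Cplus, Copp; simpl; field; exact Hs0. }
rewrite Rabs_mult in B.
assert (0 < Rabs s) by now apply Rabs_pos_lt.
apply Rle_lt_trans with (eps / 2); [|lra].
apply Rmult_le_reg_l with (Rabs s); lra.
Qed.

Lemma Rderiv_Im (g : R -> C) (t : R) (l : C) :
  Rderiv g t l -> is_derive (fun s => Im (g s)) t (Im l).
Proof.
intros H; apply is_derive_Reals; intros eps Heps.
destruct (H (eps / 2) ltac:(lra)) as [d [Hd K]].
exists (mkposreal d Hd); simpl; intros s Hs0 Hs.
specialize (K (t + s)).
replace (t + s - t) with s in K by ring; specialize (K Hs).
pose proof (Rle_trans _ _ _ (Im_le_Cmod _) K) as B.
replace (Im (g (t + s)%R - g t - RtoC s * l)%C)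
  with (s * ((Im (g (t + s)%R) - Im (g t)) / s - Im l)) in B.
2:{ unfold Im, RtoC, Cminus, Cmult, Cplus, Copp; simpl; field; exact Hs0. }
rewrite Rabs_mult in B.
assert (0 < Rabs s) by now apply Rabs_pos_lt.
apply Rle_lt_trans with (eps / 2); [|lra].
apply Rmult_le_reg_l with (Rabs s); lra.
Qed.

Lemma Rcont_Re (g : R -> C) (t : R) : Rcont g t -> continuity_pt (fun s => Re (g s)) t.
Proof.
intros H eps Heps; destruct (H eps Heps) as [d [Hd K]].
exists d; split; [exact Hd|]; intros s [_ Hs].
simpl; unfold R_dist.
eapply Rle_lt_trans; [exact (re_le_Cmod (g s - g t)%C) | now apply K].
Qed.

Lemma Rcont_Im (g : R -> C) (t : R) : Rcont g t -> continuity_pt (fun s => Im (g s)) t.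
Proof.
intros H eps Heps; destruct (H eps Heps) as [d [Hd K]].
exists d; split; [exact Hd|]; intros s [_ Hs].
simpl; unfold R_dist.
eapply Rle_lt_trans; [exact (Im_le_Cmod (g s - g t)%C) | now apply K].
Qed.

(** Suited to lifts, whose derivative is obtained only for [0 < t < 1] while continuity extends to
    the end points. *)
Lemma MVT_open (f df : R -> R) (a b : R) :
  a < b ->
  (forall t, a < t < b -> is_derive f t (df t)) ->
  (forall t, a <= t <= b -> continuity_pt f t) ->
  exists t, a < t < b /\ f b - f a = df t * (b - a).
Proof.
intros Hab Hd Hc.
assert (pr : forall t, a < t < b -> derivable_pt f t).
{ intros t Ht; exists (df t); now apply is_derive_Reals, Hd. }
destruct (MVT f id a b pr (fun t _ => derivable_pt_id t) Hab Hc) as [t [P E]].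
- intros t _; apply derivable_continuous_pt, derivable_pt_id.
- exists t; split; [exact P|].
  rewrite derive_pt_id in E; unfold id in E.
  rewrite (derive_pt_eq_0 f t (df t)) in E by now apply is_derive_Reals, Hd.
  lra.
Qed.

Lemma Rderiv_segment (z w : C) (t : R) :
  Rderiv (fun s => w + RtoC s * (z - w))%C t (z - w)%C.
Proof.
intros eps Heps; exists 1; split; [lra|]; intros s _.
replace (w + RtoC s * (z - w) - (w + RtoC t * (z - w)) - RtoC (s - t) * (z - w))%C
  with (RtoC 0) by (rewrite RtoC_minus; ring).
rewrite Cmod_0; apply Rmult_le_pos; [lra | apply Rabs_pos].
Qed.

Lemma Cmod_segment_sub (z w p : C) (d t : R) :
  0 <= t <= 1 -> Cmod (z - p)%C <= d -> Cmod (w - p)%C <= d ->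
  Cmod (w + RtoC t * (z - w) - p)%C <= d.
Proof.
intros Ht Hz Hw.
replace (w + RtoC t * (z - w) - p)%C
  with (RtoC t * (z - p) + RtoC (1 - t) * (w - p))%C by (rewrite RtoC_minus; ring).
eapply Rle_trans; [apply Cmod_triangle|].
rewrite !Cmod_mult, !Cmod_R, !Rabs_pos_eq by lra.
nra.
Qed.

Lemma Cderiv_sub_linear (f : C -> C) (z l k : C) :
  Cderiv f z l -> Cderiv (fun w => f w - k * w)%C z (l - k)%C.
Proof.
intros H eps Heps; destruct (H eps Heps) as [d [Hd K]].
exists d; split; [exact Hd|]; intros w Hw; eapply Rle_trans; [|apply K, Hw].
right; f_equal; ring.
Qed.

Lemma Cderiv_scal (f : C -> C) (z l k : C) :
  Cderiv f z l -> Cderiv (fun w => k * f w)%C z (k * l)%C.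
Proof.
intros H eps Heps.
pose proof (Cmod_ge_0 k) as Hk.
assert (He : 0 < eps / (Cmod k + 1)) by (apply Rdiv_lt_0_compat; lra).
destruct (H _ He) as [d [Hd K]].
exists d; split; [exact Hd|]; intros w Hw.
replace (k * f w - k * f z - k * l * (w - z))%C
  with (k * (f w - f z - l * (w - z)))%C by ring.
rewrite Cmod_mult; specialize (K w Hw).
apply Rle_trans with ((Cmod k + 1) * (eps / (Cmod k + 1) * Cmod (w - z)%C)).
- apply Rmult_le_compat; try lra; apply Cmod_ge_0.
- right; field; lra.
Qed.

Lemma Re_conj_mult_self (E : C) : Re (Cconj E * E)%C = Cmod E * Cmod E.
Proof.
replace (Cmod E * Cmod E) with (Cmod E ^ 2) by ring.
rewrite Cmod2_alt; destruct E as [x y]; unfold Re, Im, Cconj, Cmult; simpl; ring.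
Qed.

(* The real mean value theorem applied to [Re (conj E * F)] along the segment,
   where [F z = f z - k z] and [E] is the total increment of [F]. *)
Lemma complex_mean_value_bound (f f' : C -> C) (p k z w : C) (d eps : R) :
  (forall a, Cmod (a - p)%C <= d -> Cderiv f a (f' a) /\ Cmod (f' a - k)%C <= eps) ->
  Cmod (z - p)%C <= d -> Cmod (w - p)%C <= d ->
  Cmod (f z - f w - k * (z - w))%C <= eps * Cmod (z - w)%C.
Proof.
intros H Hz Hw.
set (E := (f z - f w - k * (z - w))%C).
set (s := fun t : R => (w + RtoC t * (z - w))%C).
set (F := fun t : R => (Cconj E * (f (s t) - k * s t))%C).
assert (HF : forall t, 0 <= t <= 1 ->
  Rderiv F t (Cconj E * (f' (s t) - k) * (z - w))%C).
{ intros t Ht.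
  apply (Rderiv_comp (fun a => Cconj E * (f a - k * a))%C s); [apply Rderiv_segment|].
  apply (Cderiv_scal (fun a => f a - k * a)%C), Cderiv_sub_linear, H.
  now apply Cmod_segment_sub. }
destruct (MVT_open (fun t => Re (F t))
  (fun t => Re (Cconj E * (f' (s t) - k) * (z - w))%C) 0 1 Rlt_0_1) as [t [Ht Et]].
- intros t Ht; apply Rderiv_Re, HF; lra.
- intros t Ht; apply Rcont_Re; eapply Rderiv_Rcont, HF, Ht.
- assert (E1 : Re (F 1) - Re (F 0) = Cmod E * Cmod E).
  { rewrite <- Re_conj_mult_self.
    unfold F, s, E; replace (w + RtoC 1 * (z - w))%C with z by ring.
    replace (w + RtoC 0 * (z - w))%C with w by ring.
    change (Re ?a - Re ?b) with (Re (a - b)%C); f_equal; ring. }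
  rewrite E1 in Et.
  destruct (H (s t)) as [_ Hk]; [apply Cmod_segment_sub; lra|].
  pose proof (re_le_Cmod (Cconj E * (f' (s t) - k) * (z - w))%C) as B.
  rewrite !Cmod_mult, Cmod_conj in B.
  pose proof (Rle_abs (Re (Cconj E * (f' (s t) - k) * (z - w))%C)) as B'.
  pose proof (Cmod_ge_0 E) as HE; pose proof (Cmod_ge_0 (z - w)%C) as Hzw.
  assert (Cmod E * Cmod (f' (s t) - k)%C * Cmod (z - w)%C
          <= Cmod E * (eps * Cmod (z - w)%C)).
  { rewrite Rmult_assoc; apply Rmult_le_compat_l; [exact HE|].
    now apply Rmult_le_compat_r. }
  (* The estimate reads [|E|^2 <= |E| eps |z - w|]. Cancel [|E|] if it is positive; if [E = 0], the
     bound follows from [0 <= |f' - k| <= eps]. *)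
  destruct HE as [HE | HE].
  + apply Rmult_le_reg_l with (Cmod E); lra.
  + rewrite <- HE; apply Rmult_le_pos; [|exact Hzw].
    eapply Rle_trans; [apply Cmod_ge_0 | exact Hk].
Qed.

(** * Local surjectivity by Newton iteration *)

(** Completeness of [R] is applied to the real and imaginary parts separately; adding the two
    coordinate errors produces the factor 2. *)
Lemma Cauchy_geometric_limit (z : nat -> C) (d : R) :
  (forall n m, Cmod (z (n + m)%nat - z n)%C <= d * (1 / 2) ^ n) ->
  exists L, forall n, Cmod (L - z n)%C <= 2 * (d * (1 / 2) ^ n).
Proof.
intros H.
assert (H0 : 0 <= d).
{ pose proof (H 0%nat 0%nat) as E; simpl in E.
  pose proof (Cmod_ge_0 (z 0%nat - z 0%nat)%C); lra. }
assert (Hsmall : forall eps, 0 < eps -> exists N, forall n, (n >= N)%nat ->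
  d * (1 / 2) ^ n < eps).
{ intros eps Heps.
  assert (Hq : 0 < eps / (d + 1)) by (apply Rdiv_lt_0_compat; lra).
  destruct (pow_lt_1_zero (1 / 2) ltac:(rewrite Rabs_pos_eq; lra) _ Hq) as [N HN].
  exists N; intros n Hn; specialize (HN n Hn).
  pose proof (pow_lt (1 / 2) n ltac:(lra)) as Hp.
  rewrite Rabs_pos_eq in HN by lra.
  apply Rle_lt_trans with ((d + 1) * (1 / 2) ^ n); [nra|].
  replace eps with ((d + 1) * (eps / (d + 1))) by (field; lra).
  apply Rmult_lt_compat_l; lra. }
assert (Hlim : forall pr : C -> R, (forall x, Rabs (pr x) <= Cmod x) ->
  (forall x y, pr (x - y)%C = pr x - pr y) ->
  exists l, forall n, Rabs (l - pr (z n)) <= d * (1 / 2) ^ n).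
{ intros pr Hpr Hsub.
  assert (Hcl : forall n m, Rabs (pr (z (n + m)%nat) - pr (z n)) <= d * (1 / 2) ^ n).
  { intros n m; rewrite <- Hsub; eapply Rle_trans; [apply Hpr | apply H]. }
  destruct (Rcomplete.R_complete (fun n => pr (z n))) as [l Hl].
  { intros eps Heps; destruct (Hsmall (eps / 2) ltac:(lra)) as [N HN].
    exists N; intros n m Hn Hm; unfold R_dist.
    pose proof (Hcl N (n - N)%nat) as A; pose proof (Hcl N (m - N)%nat) as B.
    replace (N + (n - N))%nat with n in A by lia.
    replace (N + (m - N))%nat with m in B by lia.
    specialize (HN N ltac:(lia)).
    pose proof (Rabs_triang (pr (z n) - pr (z N)) (pr (z N) - pr (z m))) as T.
    replace (pr (z n) - pr (z N) + (pr (z N) - pr (z m))) with (pr (z n) - pr (z m))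
      in T by ring.
    rewrite (Rabs_minus_sym (pr (z N))) in T; lra. }
  exists l; intros n; apply le_epsilon; intros eps Heps.
  destruct (Hl eps Heps) as [N HN].
  specialize (HN (n + N)%nat ltac:(lia)); unfold R_dist in HN.
  specialize (Hcl n N).
  pose proof (Rabs_triang (l - pr (z (n + N)%nat)) (pr (z (n + N)%nat) - pr (z n))) as T.
  replace (l - pr (z (n + N)%nat) + (pr (z (n + N)%nat) - pr (z n)))
    with (l - pr (z n)) in T by ring.
  rewrite (Rabs_minus_sym l (pr (z (n + N)%nat))) in T; lra. }
destruct (Hlim Re re_le_Cmod ltac:(reflexivity)) as [x Hx].
destruct (Hlim Im Im_le_Cmod ltac:(reflexivity)) as [y Hy].
exists (x, y); intros n.
eapply Rle_trans; [apply Cmod_le_Re_Im|].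
specialize (Hx n); specialize (Hy n).
change (Re ((x, y) - z n)%C) with (x - Re (z n)).
change (Im ((x, y) - z n)%C) with (y - Im (z n)); lra.
Qed.

(* The solution is the limit of the simplified Newton iteration
   [z - (f z - v) / k] started at [a], a contraction of ratio 1/2. *)
Lemma newton_surjective (f : C -> C) (a k v : C) (d : R) :
  0 < d -> k <> RtoC 0 ->
  (forall z w, Cmod (z - a)%C <= d -> Cmod (w - a)%C <= d ->
     Cmod (f z - f w - k * (z - w))%C <= Cmod k / 2 * Cmod (z - w)%C) ->
  Cmod (v - f a)%C <= Cmod k * d / 8 ->
  exists z, Cmod (z - a)%C <= d /\ f z = v.
Proof.
intros Hd Hk Hf Hv.
assert (Hk' : 0 < Cmod k) by now apply Cmod_gt_0.
set (T := fun z => (z - (f z - v) / k)%C).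
assert (HT : forall z w, Cmod (z - a)%C <= d -> Cmod (w - a)%C <= d ->
  Cmod (T z - T w)%C <= 1 / 2 * Cmod (z - w)%C).
{ intros z w Hz Hw; specialize (Hf z w Hz Hw).
  apply Rmult_le_reg_l with (Cmod k); [exact Hk'|].
  rewrite <- Cmod_mult.
  replace (k * (T z - T w))%C with (- (f z - f w - k * (z - w)))%C
    by (unfold T; field; exact Hk).
  rewrite Cmod_opp; lra. }
assert (HTa : Cmod (T a - a)%C <= d / 8).
{ apply Rmult_le_reg_l with (Cmod k); [exact Hk'|].
  rewrite <- Cmod_mult.
  replace (k * (T a - a))%C with (v - f a)%C by (unfold T; field; exact Hk).
  lra. }
set (z := fix z n := match n with O => a | S m => T (z m) end).
(* The steps [d / 8 * (1 / 2) ^ n] sum to at most [d / 4], so the iterates stay in the disk where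
   [T] contracts. *)
assert (Hz : forall n, Cmod (z n - a)%C <= d / 4 * (1 - (1 / 2) ^ n) /\
  Cmod (z (S n) - z n)%C <= d / 8 * (1 / 2) ^ n).
{ induction n as [|n [IH1 IH2]].
  - split.
    + simpl; replace (a - a)%C with (RtoC 0) by ring; rewrite Cmod_0; lra.
    + change (z 1%nat) with (T a); simpl; lra.
  - pose proof (pow_lt (1 / 2) n ltac:(lra)) as Hp.
    assert (A : Cmod (z (S n) - a)%C <= d / 4 * (1 - (1 / 2) ^ S n)).
    { eapply Rle_trans; [apply (Cmod_sub_triangle _ (z n))|].
      simpl ((1 / 2) ^ S n); nra. }
    assert (0 < (1 / 2) ^ S n) by (apply pow_lt; lra).
    split; [exact A|].
    change (z (S (S n))) with (T (z (S n))).
    change (z (S n)) with (T (z n)) at 2.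
    eapply Rle_trans; [apply HT; nra|].
    simpl ((1 / 2) ^ S n); lra. }
assert (Hcau : forall n m, Cmod (z (n + m)%nat - z n)%C <=
  d / 4 * ((1 / 2) ^ n - (1 / 2) ^ (n + m))).
{ intros n; induction m as [|m IH].
  - rewrite Nat.add_0_r; replace (z n - z n)%C with (RtoC 0) by ring.
    rewrite Cmod_0; lra.
  - rewrite Nat.add_succ_r.
    eapply Rle_trans; [apply (Cmod_sub_triangle _ (z (n + m)%nat))|].
    destruct (Hz (n + m)%nat) as [_ B]; simpl ((1 / 2) ^ S (n + m)); lra. }
destruct (Cauchy_geometric_limit z (d / 4)) as [L HL].
{ intros n m; eapply Rle_trans; [apply Hcau|].
  pose proof (pow_lt (1 / 2) (n + m) ltac:(lra)); nra. }
assert (HLa : Cmod (L - a)%C <= d).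
{ specialize (HL 0%nat); simpl in HL; lra. }
exists L; split; [exact HLa|].
(* Since [T (z N) = z (S N)], the distance from [T L] to [L] is at most [|L - z N| / 2 + |L - z (S
   N)| <= d / 2 * (1 / 2) ^ N]. *)
assert (HTL : Cmod (T L - L)%C = 0).
{ apply Rle_antisym; [|apply Cmod_ge_0].
  apply le_epsilon; intros eps Heps.
  assert (Hq : 0 < eps / d) by now apply Rdiv_lt_0_compat.
  destruct (pow_lt_1_zero (1 / 2) ltac:(rewrite Rabs_pos_eq; lra) _ Hq) as [N HN].
  specialize (HN N (le_n N)).
  pose proof (pow_lt (1 / 2) N ltac:(lra)) as Hp.
  rewrite Rabs_pos_eq in HN by lra.
  pose proof (HL N) as A; pose proof (HL (S N)) as B.
  destruct (Hz N) as [B1 _].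
  assert (Cmod (T L - T (z N))%C <= 1 / 2 * Cmod (L - z N)%C) by (apply HT; nra).
  pose proof (Cmod_sub_triangle (T L) (T (z N)) L) as Tr.
  change (T (z N)) with (z (S N)) in *.
  rewrite (Cmod_sub_sym (z (S N)) L) in Tr.
  simpl ((1 / 2) ^ S N) in B.
  assert (d * (1 / 2) ^ N < eps).
  { replace eps with (d * (eps / d)) by (field; lra).
    now apply Rmult_lt_compat_l. }
  lra. }
apply Cmod_eq_0 in HTL.
replace (f L) with (v - k * (T L - L))%C by (unfold T; field; exact Hk).
rewrite HTL; ring.
Qed.

(** * Compactness of closed disks *)

(** A Lebesgue number argument: finitely many local scales cover the square around the disk, and by
    monotonicity of [P] a common lower bound of these scales serves everywhere. *)
Lemma disk_uniform_scale (rho : R) (P : C -> R -> Prop) :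
  (forall a d d', 0 < d' <= d -> P a d -> P a d') ->
  (forall p, Cmod p <= rho -> exists d, 0 < d /\ forall a, Cmod (a - p)%C < d -> P a d) ->
  exists d, 0 < d /\ forall a, Cmod a <= rho -> P a d.
Proof.
intros Hmon Hloc.
(* The factor 2 passes from coordinatewise closeness to the modulus. At a centre outside the disk,
   [2 d] is its distance to the disk, so no [a] satisfies the premises. *)
assert (Hex : forall x y : R, exists d : posreal, forall a,
  Cmod a <= rho -> Cmod (a - (x, y))%C < 2 * d -> P a d).
{ intros x y.
  destruct (Rle_lt_dec (Cmod (x, y)) rho) as [Hp | Hp].
  - destruct (Hloc _ Hp) as [d [Hd K]].
    assert (Hd2 : 0 < d / 2) by lra.
    exists (mkposreal (d / 2) Hd2); simpl; intros a _ Ha.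
    apply (Hmon a d); [lra|]; apply K; lra.
  - assert (Hd : 0 < (Cmod (x, y) - rho) / 2) by lra.
    exists (mkposreal _ Hd); simpl; intros a Ha Hxa; exfalso.
    rewrite Cmod_sub_sym in Hxa.
    pose proof (Cmod_le_add_sub (x, y) a); lra. }
pose (del := fun x y => proj1_sig (constructive_indefinite_description _ (Hex x y))).
assert (Hdel : forall x y a, Cmod a <= rho ->
  Cmod (a - (x, y))%C < 2 * del x y -> P a (del x y)).
{ intros x y; exact (proj2_sig (constructive_indefinite_description _ (Hex x y))). }
destruct (compactness_value_2d (- rho) rho (- rho) rho del) as [d Hd].
exists d; split; [apply cond_pos|]; intros a Ha.
(* The compactness statement asserts its covering point only under a double negation. *)
apply NNPP; intros Hn.
apply (Hd (Re a) (Im a)).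
- pose proof (re_le_Cmod a); apply Rabs_le_between; lra.
- pose proof (Im_le_Cmod a); apply Rabs_le_between; lra.
- intros (x & y & _ & _ & Hx & Hy & Hdd); apply Hn.
  apply (Hmon a (del x y)); [split; [apply cond_pos | exact Hdd]|].
  apply Hdel; [exact Ha|].
  eapply Rle_lt_trans; [apply Cmod_le_Re_Im|].
  change (Re (a - (x, y))%C) with (Re a - x).
  change (Im (a - (x, y))%C) with (Im a - y); lra.
Qed.

(** * Lifts of a segment through [h] *)

(** Precomposing with this 1-Lipschitz retraction extends a path on [[0, 1]] continuously to all of
    [R]. *)
Definition clamp (t : R) : R := Rmax 0 (Rmin 1 t).

Lemma clamp_range (t : R) : 0 <= clamp t <= 1.
Proof. unfold clamp, Rmax, Rmin; repeat destruct Rle_dec; lra. Qed.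

Lemma clamp_id (t : R) : 0 <= t <= 1 -> clamp t = t.
Proof. unfold clamp, Rmax, Rmin; repeat destruct Rle_dec; lra. Qed.

Lemma clamp_lipschitz (s t : R) : Rabs (clamp s - clamp t) <= Rabs (s - t).
Proof.
unfold clamp, Rmax, Rmin; repeat destruct Rle_dec; unfold Rabs;
  repeat destruct Rcase_abs; lra.
Qed.

(* The path is parametrized by all of [R] so that continuity is two-sided at 0 and 1;
   its values outside [[0, 1]] carry no information. *)
Record segment_lift (h : C -> C) (z0 z1 : C) (g : R -> C) : Prop := {
  lift_cont : forall t, Rcont g t;
  lift_start : g 0 = z0;
  lift_end : g 1 = z1;
  lift_in_disk : forall t, 0 <= t <= 1 -> Cmod (g t) < 1;
  lift_eq : forall t, 0 <= t <= 1 -> h (g t) = (h z0 + RtoC t * (h z1 - h z0))%C }.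

Section Convex.

Variables h h1 h2 : C -> C.
Hypothesis h_deriv : forall z, Cmod z < 1 -> Cderiv h z (h1 z).
Hypothesis h1_deriv : forall z, Cmod z < 1 -> Cderiv h1 z (h2 z).
Hypothesis h1_neq0 : forall z, Cmod z < 1 -> h1 z <> RtoC 0.
Hypothesis h_convex : forall z, Cmod z < 1 -> 0 < Re (1 + z * h2 z / h1 z)%C.

(** * Monotone quantities along a lift *)

Section AlongLift.

Variables (z0 z1 : C) (g : R -> C).
Hypothesis g_lift : segment_lift h z0 z1 g.

Let c := (h z1 - h z0)%C.
Let phi (t : R) := Cmod (g t) ^ 2.
Let psi (t : R) := Re (Cconj c * (g t * h1 (g t)))%C.

Lemma lift_Rderiv (t : R) : 0 < t < 1 -> Rderiv g t (c / h1 (g t))%C.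
Proof.
intros Ht.
assert (Hin : Cmod (g t) < 1) by (apply (lift_in_disk _ _ _ _ g_lift); lra).
(* Within [Rmin t (1 - t)] of [t] the parameter stays in [[0, 1]], where the lift equation holds. *)
apply (Rderiv_lift h g t (Rmin t (1 - t))).
- apply (lift_cont _ _ _ _ g_lift).
- now apply h_deriv.
- now apply h1_neq0.
- apply Rmin_glb_lt; lra.
- intros s Hs.
  pose proof (Rmin_l t (1 - t)); pose proof (Rmin_r t (1 - t)).
  assert (0 <= s <= 1) by (apply Rabs_lt_between in Hs; lra).
  rewrite !(lift_eq _ _ _ _ g_lift) by lra.
  rewrite RtoC_minus; unfold c; ring.
Qed.

Lemma lift_cont_h1 (t : R) : 0 <= t <= 1 -> Rcont (fun s => h1 (g s)) t.
Proof.
intros Ht; apply (Rcont_comp h1 g t (h2 (g t))).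
- apply (lift_cont _ _ _ _ g_lift).
- apply h1_deriv, (lift_in_disk _ _ _ _ g_lift), Ht.
Qed.

Lemma phi_alt (t : R) : phi t = Re (g t) * Re (g t) + Im (g t) * Im (g t).
Proof. unfold phi; rewrite Cmod2_alt; ring. Qed.

Lemma psi_alt (t : R) :
  psi t = Re c * (Re (g t) * Re (h1 (g t)) - Im (g t) * Im (h1 (g t))) +
          Im c * (Re (g t) * Im (h1 (g t)) + Im (g t) * Re (h1 (g t))).
Proof. unfold psi, Re, Im, Cconj, Cmult; cbn [fst snd]; ring. Qed.

Lemma phi_cont (t : R) : continuity_pt phi t.
Proof.
pose proof (lift_cont _ _ _ _ g_lift t) as Hg.
apply (continuity_pt_ext (fun s => Re (g s) * Re (g s) + Im (g s) * Im (g s))).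
- intros s; symmetry; apply phi_alt.
- pose proof (Rcont_Re _ _ Hg); pose proof (Rcont_Im _ _ Hg).
  apply continuity_pt_plus; now apply continuity_pt_mult.
Qed.

Lemma psi_cont (t : R) : 0 <= t <= 1 -> continuity_pt psi t.
Proof.
intros Ht; pose proof (lift_cont _ _ _ _ g_lift t) as Hg.
pose proof (lift_cont_h1 t Ht) as Hh.
pose proof (Rcont_Re _ _ Hg); pose proof (Rcont_Im _ _ Hg).
pose proof (Rcont_Re _ _ Hh); pose proof (Rcont_Im _ _ Hh).
apply (continuity_pt_ext (fun s =>
  Re c * (Re (g s) * Re (h1 (g s)) - Im (g s) * Im (h1 (g s))) +
  Im c * (Re (g s) * Im (h1 (g s)) + Im (g s) * Re (h1 (g s))))).
- intros s; symmetry; apply psi_alt.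
- apply continuity_pt_plus; (apply continuity_pt_mult;
    [apply continuity_pt_const; now intros ? ?|]);
    [apply continuity_pt_minus | apply continuity_pt_plus]; now apply continuity_pt_mult.
Qed.

(** Here [phi' = 2 Re (conj g * c / h1 g)]; multiplying numerator and denominator by the conjugate
    of [h1 g] turns the real part into [psi / |h1 g|^2]. *)
Lemma phi_deriv (t : R) :
  0 < t < 1 -> is_derive phi t (2 * psi t / Cmod (h1 (g t)) ^ 2).
Proof.
intros Ht; pose proof (lift_Rderiv t Ht) as D.
pose proof (Rderiv_Re _ _ _ D) as Dx; pose proof (Rderiv_Im _ _ _ D) as Dy.
assert (Hn : h1 (g t) <> RtoC 0)
  by (apply h1_neq0, (lift_in_disk _ _ _ _ g_lift); lra).
apply (is_derive_ext (fun s => Re (g s) * Re (g s) + Im (g s) * Im (g s))).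
- intros s; symmetry; apply phi_alt.
- evar_last.
  + apply (is_derive_plus (fun s => Re (g s) * Re (g s)) (fun s => Im (g s) * Im (g s)));
      apply (is_derive_mult (K := R_AbsRing)); try eassumption;
      intros n m; apply Rmult_comm.
  + assert (Hp : Re (h1 (g t)) ^ 2 + Im (h1 (g t)) ^ 2 <> 0).
    { rewrite <- Cmod2_alt; apply Rgt_not_eq, pow_lt; now apply Cmod_gt_0. }
    unfold psi; rewrite Cmod2_alt; revert Hp.
    generalize (h1 (g t)) as k; generalize (g t) as w; generalize c as b.
    intros [c1 c2] [x y] [p q]; unfold Re, Im; simpl; intros Hp.
    unfold plus, mult; simpl.
    match goal with |- @eq _ ?a ?b => change (@eq R a b) end; field; lra.
Qed.

(** The chain rule gives [(g * h1 g)' = g' (h1 g + g * h2 g) = c (1 + g * h2 g / h1 g)], and the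
    factor [conj c] makes the coefficient [|c|^2]. *)
Lemma psi_deriv (t : R) : 0 < t < 1 ->
  is_derive psi t (Cmod c ^ 2 * Re (1 + g t * h2 (g t) / h1 (g t))%C).
Proof.
intros Ht; pose proof (lift_Rderiv t Ht) as D.
assert (Hin : Cmod (g t) < 1) by (apply (lift_in_disk _ _ _ _ g_lift); lra).
pose proof (h1_neq0 _ Hin) as Hn.
pose proof (Rderiv_comp h1 g t _ _ D (h1_deriv _ Hin)) as Dh.
pose proof (Rderiv_Re _ _ _ D) as Dx; pose proof (Rderiv_Im _ _ _ D) as Dy.
pose proof (Rderiv_Re _ _ _ Dh) as Dp; pose proof (Rderiv_Im _ _ _ Dh) as Dq.
apply (is_derive_ext (fun s =>
  Re c * (Re (g s) * Re (h1 (g s)) - Im (g s) * Im (h1 (g s))) +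
  Im c * (Re (g s) * Im (h1 (g s)) + Im (g s) * Re (h1 (g s))))).
- intros s; symmetry; apply psi_alt.
- evar_last.
  + apply (is_derive_plus
      (fun s => Re c * (Re (g s) * Re (h1 (g s)) - Im (g s) * Im (h1 (g s))))
      (fun s => Im c * (Re (g s) * Im (h1 (g s)) + Im (g s) * Re (h1 (g s)))));
      apply is_derive_scal.
    * apply (is_derive_minus (fun s => Re (g s) * Re (h1 (g s)))
        (fun s => Im (g s) * Im (h1 (g s))));
        apply (is_derive_mult (K := R_AbsRing)); try eassumption;
        intros n m; apply Rmult_comm.
    * apply (is_derive_plus (fun s => Re (g s) * Im (h1 (g s)))
        (fun s => Im (g s) * Re (h1 (g s))));
        apply (is_derive_mult (K := R_AbsRing)); try eassumption;
        intros n m; apply Rmult_comm.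
  + assert (Hp : Re (h1 (g t)) ^ 2 + Im (h1 (g t)) ^ 2 <> 0).
    { rewrite <- Cmod2_alt; apply Rgt_not_eq, pow_lt; now apply Cmod_gt_0. }
    rewrite Cmod2_alt; revert Hp.
    generalize (h2 (g t)) as l; generalize (h1 (g t)) as k.
    generalize (g t) as w; generalize c as b.
    intros [c1 c2] [x y] [p q] [r s]; unfold Re, Im; simpl; intros Hp.
    unfold minus, plus, opp, mult; simpl; unfold plus; simpl.
    match goal with |- @eq _ ?a ?b => change (@eq R a b) end; field; lra.
Qed.

(** If [c = 0] then [g' = c / h1 g] vanishes. Once lifts are known to exist, this is the injectivity
    of [h]. *)
Lemma lift_const : c = RtoC 0 -> z1 = z0.
Proof.
intros Hc.
assert (Hz : forall pr : C -> R, pr (RtoC 0) = 0 ->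
  (forall t l, Rderiv g t l -> is_derive (fun s => pr (g s)) t (pr l)) ->
  (forall t, Rcont g t -> continuity_pt (fun s => pr (g s)) t) -> pr z1 = pr z0).
{ intros pr P0 Pd Pc.
  rewrite <- (lift_start _ _ _ _ g_lift), <- (lift_end _ _ _ _ g_lift).
  destruct (MVT_open (fun s => pr (g s)) (fun _ => 0) 0 1 Rlt_0_1) as [t [_ E]].
  - intros t Ht; rewrite <- P0; apply Pd.
    pose proof (lift_Rderiv t Ht) as D; rewrite Hc in D.
    replace (RtoC 0) with (RtoC 0 / h1 (g t))%C; [exact D|].
    unfold Cdiv; ring.
  - intros t _; apply Pc, (lift_cont _ _ _ _ g_lift).
  - lra. }
apply injective_projections.
- exact (Hz Re eq_refl (Rderiv_Re g) (Rcont_Re g)).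
- exact (Hz Im eq_refl (Rderiv_Im g) (Rcont_Im g)).
Qed.

(** An interior value above both end values would make [phi] rise and then fall, so [psi] would be
    positive at some [s1] and negative at some later [s2], although [psi' > 0]. *)
Lemma phi_le_max (t : R) : c <> RtoC 0 -> 0 <= t <= 1 -> phi t <= Rmax (phi 0) (phi 1).
Proof.
intros Hc Ht; apply Rnot_lt_le; intros Hlt.
pose proof (Rmax_l (phi 0) (phi 1)); pose proof (Rmax_r (phi 0) (phi 1)).
assert (Ht' : 0 < t < 1).
{ destruct Ht as [[A | A] [B | B]]; try subst; lra. }
destruct (MVT_open phi (fun t => 2 * psi t / Cmod (h1 (g t)) ^ 2) 0 t)
  as [s1 [Hs1 E1]]; try lra.
{ intros; apply phi_deriv; lra. }
{ intros; apply phi_cont. }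
destruct (MVT_open phi (fun t => 2 * psi t / Cmod (h1 (g t)) ^ 2) t 1)
  as [s2 [Hs2 E2]]; try lra.
{ intros; apply phi_deriv; lra. }
{ intros; apply phi_cont. }
destruct (MVT_open psi (fun t => Cmod c ^ 2 * Re (1 + g t * h2 (g t) / h1 (g t))%C) s1 s2)
  as [s [Hs E]]; try lra.
{ intros; apply psi_deriv; lra. }
{ intros; apply psi_cont; lra. }
assert (Hpos : forall s, 0 <= s <= 1 -> 0 < / Cmod (h1 (g s)) ^ 2).
{ intros; apply Rinv_0_lt_compat, pow_lt, Cmod_gt_0, h1_neq0.
  now apply (lift_in_disk _ _ _ _ g_lift). }
pose proof (Hpos s1 ltac:(lra)) as P1; pose proof (Hpos s2 ltac:(lra)) as P2.
unfold Rdiv in E1, E2.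
assert (Q1 : 0 < psi s1).
{ apply Rnot_le_lt; intros Q.
  assert (psi s1 * / Cmod (h1 (g s1)) ^ 2 <= 0) by nra; nra. }
assert (Q2 : psi s2 < 0).
{ apply Rnot_le_lt; intros Q.
  assert (0 <= psi s2 * / Cmod (h1 (g s2)) ^ 2) by nra; nra. }
assert (0 < Cmod c ^ 2) by (apply pow_lt; now apply Cmod_gt_0).
assert (0 < Re (1 + g s * h2 (g s) / h1 (g s))%C).
{ apply h_convex, (lift_in_disk _ _ _ _ g_lift); lra. }
assert (0 < Cmod c ^ 2 * Re (1 + g s * h2 (g s) / h1 (g s))%C * (s2 - s1)).
{ apply Rmult_lt_0_compat; [now apply Rmult_lt_0_compat | lra]. }
lra.
Qed.

(** From [|Re w| <= |w|]. It controls the term [- phi' psi / 2] in the derivative of the projection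
    of [u] onto the direction [c]. *)
Lemma psi_sqr_le (t : R) : psi t ^ 2 <= Cmod c ^ 2 * phi t * Cmod (h1 (g t)) ^ 2.
Proof.
unfold psi, phi.
pose proof (re_le_Cmod (Cconj c * (g t * h1 (g t)))%C) as B.
rewrite !Cmod_mult, Cmod_conj in B.
rewrite <- (Rabs_pos_eq (_ ^ 2)) at 1 by apply pow2_ge_0.
rewrite <- RPow_abs, <- !Rpow_mult_distr.
apply pow_incr; split; [apply Rabs_pos | lra].
Qed.

Lemma u_of_separates : c <> RtoC 0 -> u_of h h1 z0 <> u_of h h1 z1.
Proof.
intros Hc Heq.
(* The part of [Re (conj c * u (g t))] that varies with [t]: the lifted [h] contributes [|c|^2 t],
   the correction term [(1 - phi) psi / 2]. *)
set (V := fun t => Cmod c ^ 2 * t + / 2 * ((1 - phi t) * psi t)).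
assert (HV : forall t, 0 <= t <= 1 ->
  Re (Cconj c * u_of h h1 (g t))%C = Re (Cconj c * h z0)%C + V t).
{ intros t Ht; unfold u_of, V, psi.
  rewrite (lift_eq _ _ _ _ g_lift t Ht); fold (phi t); fold c.
  rewrite Cmod2_alt.
  generalize (phi t) as f; generalize (h1 (g t)) as k; generalize (g t) as w.
  generalize (h z0) as m; generalize c as b.
  intros [c1 c2] [m1 m2] [x y] [p q] f.
  unfold Re, Im, Cconj, Cmult, Cplus, RtoC; simpl; field. }
destruct (MVT_open V (fun t =>
  Cmod c ^ 2 + / 2 * ((1 - phi t) * (Cmod c ^ 2 * Re (1 + g t * h2 (g t) / h1 (g t))%C)
    - (2 * psi t / Cmod (h1 (g t)) ^ 2) * psi t)) 0 1 Rlt_0_1) as [t [Ht E]].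
{ intros t Ht; unfold V; evar_last.
  - apply (is_derive_plus (fun t => Cmod c ^ 2 * t)
      (fun t => / 2 * ((1 - phi t) * psi t))).
    + apply is_derive_scal, is_derive_id.
    + apply is_derive_scal.
      apply (is_derive_mult (K := R_AbsRing) (fun t => 1 - phi t) psi).
      * apply (is_derive_minus (fun _ => 1) phi);
          [apply is_derive_const | now apply phi_deriv].
      * now apply psi_deriv.
      * intros n m; apply Rmult_comm.
  - unfold plus, minus, opp, mult, zero, one; simpl; unfold minus, plus, opp, mult; simpl; unfold plus; simpl.
    match goal with |- @eq _ ?a ?b => change (@eq R a b) end.
    unfold Rdiv; ring. }
{ intros t Ht; unfold V.
  apply continuity_pt_plus; apply continuity_pt_mult.
  - apply continuity_pt_const; now intros ? ?.
  - apply derivable_continuous_pt, derivable_pt_id.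
  - apply continuity_pt_const; now intros ? ?.
  - apply continuity_pt_mult; [|now apply psi_cont].
    apply continuity_pt_minus; [|apply phi_cont].
    apply continuity_pt_const; now intros ? ?. }
assert (V1 : V 1 = V 0).
{ pose proof (HV 0 ltac:(lra)) as H0; pose proof (HV 1 ltac:(lra)) as H1.
  rewrite (lift_start _ _ _ _ g_lift) in H0.
  rewrite (lift_end _ _ _ _ g_lift), <- Heq in H1; lra. }
rewrite V1 in E.
assert (Hin : Cmod (g t) < 1) by (apply (lift_in_disk _ _ _ _ g_lift); lra).
assert (Hc2 : 0 < Cmod c ^ 2) by (apply pow_lt; now apply Cmod_gt_0).
assert (Hk : 0 < Cmod (h1 (g t)) ^ 2)
  by (apply pow_lt, Cmod_gt_0; now apply h1_neq0).
assert (Hphi : phi t < 1).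
{ unfold phi; pose proof (Cmod_ge_0 (g t)); nra. }
(* Half of this bound turns the leading [|c|^2] of [V'] into [|c|^2 (1 - phi)], so [V'] stays
   positive, against [V 1 = V 0]. *)
assert (Hpsi : 2 * psi t / Cmod (h1 (g t)) ^ 2 * psi t <= 2 * (Cmod c ^ 2 * phi t)).
{ apply Rmult_le_reg_l with (Cmod (h1 (g t)) ^ 2); [exact Hk|].
  replace (Cmod (h1 (g t)) ^ 2 * (2 * psi t / Cmod (h1 (g t)) ^ 2 * psi t))
    with (2 * psi t ^ 2) by (field; intros Z; rewrite Z in Hk; simpl in Hk; lra).
  pose proof (psi_sqr_le t); lra. }
pose proof (Rmult_lt_0_compat _ _ Hc2 (h_convex _ Hin)) as HP.
assert (HP' : 0 < (1 - phi t) * (Cmod c ^ 2 * Re (1 + g t * h2 (g t) / h1 (g t))%C))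
  by (apply Rmult_lt_0_compat; lra).
assert (0 < Cmod c ^ 2 * (1 - phi t)) by (apply Rmult_lt_0_compat; lra).
lra.
Qed.

(** The a priori bound: it depends only on the end points, so one compact disk serves at every stage
    of the continuation. *)
Lemma lift_Cmod_le (rho : R) (t : R) :
  Cmod z0 <= rho -> Cmod z1 <= rho -> c <> RtoC 0 -> 0 <= t <= 1 -> Cmod (g t) <= rho.
Proof.
intros H0 H1 Hc Ht.
pose proof (phi_le_max t Hc Ht) as B; unfold phi in B.
rewrite (lift_start _ _ _ _ g_lift), (lift_end _ _ _ _ g_lift) in B.
pose proof (Cmod_ge_0 z0); pose proof (Cmod_ge_0 z1); pose proof (Cmod_ge_0 (g t)).
assert (Cmod (g t) ^ 2 <= rho ^ 2).
{ eapply Rle_trans; [exact B|]; apply Rmax_lub; apply pow_incr; lra. }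
nra.
Qed.

End AlongLift.

(** * Existence of lifts by continuation *)

(** One number [d] bounds [|h1 a|] from both sides and sets the radius, so the property passes to
    smaller [d]. Radius [3 * d] covers the points within [2 * d] compared in the continuation. *)
Definition uniform_chart (a : C) (d : R) : Prop :=
  d <= Cmod (h1 a) <= / d /\
  forall z w, Cmod (z - a)%C <= 3 * d -> Cmod (w - a)%C <= 3 * d ->
    Cmod z < 1 /\
    Cmod (h z - h w - h1 a * (z - w))%C <= Cmod (h1 a) / 2 * Cmod (z - w)%C.

Lemma uniform_chart_exists (rho : R) :
  rho < 1 -> exists d, 0 < d /\ forall a, Cmod a <= rho -> uniform_chart a d.
Proof.
intros Hrho; apply disk_uniform_scale.
- intros a d d' Hd [[A B] K]; split.
  + split; [lra|].
    eapply Rle_trans; [exact B|]; apply Rinv_le_contravar; lra.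
  + intros z w Hz Hw; apply K; lra.
- intros p Hp.
  assert (Hp1 : Cmod p < 1) by lra.
  assert (Hk : 0 < Cmod (h1 p)) by now apply Cmod_gt_0, h1_neq0.
  set (k := Cmod (h1 p)) in *.
  destruct (Cderiv_cont h1 p (h2 p) (h1_deriv p Hp1) (k / 8) ltac:(lra)) as [e [He K]].
  (* Points within [3 m] of [a] are within [4 m] of [p]; the first two bounds keep these where [h1]
     varies by at most [k / 8] and inside the unit disk. The last two give [m <= |h1 a| <= / m], as
     [7 k / 8 <= |h1 a| <= 9 k / 8]. *)
  set (m := Rmin (Rmin (e / 5) ((1 - rho) / 5)) (Rmin (k / 2) (/ (2 * k)))).
  assert (Hm : 0 < m).
  { unfold m; repeat apply Rmin_glb_lt; try lra; apply Rinv_0_lt_compat; lra. }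
  assert (M1 : m <= e / 5)
    by (unfold m; eapply Rle_trans; [apply Rmin_l | apply Rmin_l]).
  assert (M2 : m <= (1 - rho) / 5)
    by (unfold m; eapply Rle_trans; [apply Rmin_l | apply Rmin_r]).
  assert (M3 : m <= k / 2)
    by (unfold m; eapply Rle_trans; [apply Rmin_r | apply Rmin_l]).
  assert (M4 : m <= / (2 * k))
    by (unfold m; eapply Rle_trans; [apply Rmin_r | apply Rmin_r]).
  exists m; split; [exact Hm|]; intros a Ha.
  assert (Kz : forall z, Cmod (z - p)%C <= 4 * m ->
    Cmod z < 1 /\ Cmod (h1 z - h1 p)%C <= k / 8).
  { intros z Hz; split.
    - pose proof (Cmod_le_add_sub z p); lra.
    - left; apply K; lra. }
  destruct (Kz a ltac:(lra)) as [Ha1 Ha2].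
  pose proof (Cmod_le_add_sub (h1 a) (h1 p)) as T1.
  pose proof (Cmod_le_add_sub (h1 p) (h1 a)) as T2.
  rewrite (Cmod_sub_sym (h1 p)) in T2; fold k in T1, T2.
  assert (H2k : 2 * k <= / m).
  { rewrite <- (Rinv_inv (2 * k)); apply Rinv_le_contravar; lra. }
  split; [lra|].
  intros z w Hz Hw.
  assert (Hzp : Cmod (z - p)%C <= 4 * m)
    by (pose proof (Cmod_sub_triangle z a p); lra).
  assert (Hwp : Cmod (w - p)%C <= 4 * m)
    by (pose proof (Cmod_sub_triangle w a p); lra).
  split; [now apply Kz|].
  (* On the disk around [p], [h1] differs from [h1 a] by at most [k / 8 + k / 8 = k / 4], which is
     below [|h1 a| / 2]. *)
  eapply Rle_trans.
  + apply (complex_mean_value_bound h h1 p (h1 a) z w (4 * m) (k / 4)); trivial.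
    intros b Hb; destruct (Kz b Hb) as [Hb1 Hb2]; split; [now apply h_deriv|].
    pose proof (Cmod_sub_triangle (h1 b) (h1 p) (h1 a)) as T.
    rewrite (Cmod_sub_sym (h1 p)) in T; lra.
  + apply Rmult_le_compat_r; [apply Cmod_ge_0 | lra].
Qed.

Lemma uniform_chart_inj (a z w : C) (d : R) :
  0 < d -> uniform_chart a d -> Cmod (z - a)%C <= 3 * d -> Cmod (w - a)%C <= 3 * d ->
  d / 2 * Cmod (z - w)%C <= Cmod (h z - h w)%C.
Proof.
intros Hd [[A _] K] Hz Hw; destruct (K z w Hz Hw) as [_ B].
pose proof (Cmod_le_add_sub (h1 a * (z - w)) (h z - h w)) as T.
rewrite (Cmod_sub_sym (h1 a * (z - w))), Cmod_mult in T.
pose proof (Cmod_ge_0 (z - w)%C); nra.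
Qed.

Definition lift_within (rho : R) (z0 z1 : C) (g : R -> C) : Prop :=
  segment_lift h z0 z1 g /\ forall t, 0 <= t <= 1 -> Cmod (g t) <= rho.

Lemma lift_within_const (rho : R) (z0 : C) :
  rho < 1 -> Cmod z0 <= rho -> lift_within rho z0 z0 (fun _ => z0).
Proof.
intros Hr Hz; split; [|intros; exact Hz].
split; trivial.
- intros t eps Heps; exists 1; split; [lra|]; intros s _.
  replace (z0 - z0)%C with (RtoC 0) by ring; now rewrite Cmod_0.
- intros; lra.
- intros; ring.
Qed.

(** Moves the end point from [z] to [z']. Newton's iteration near each [g t] finds a point above the
    new segment, and local injectivity gives continuity and the right end points. The new path might
    leave the disk of radius [rho] by up to [d]; [lift_Cmod_le] restores the bound. *)
Lemma lift_step (rho d : R) (z0 z z' : C) (g : R -> C) :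
  rho < 1 -> 0 < d -> (forall a, Cmod a <= rho -> uniform_chart a d) ->
  Cmod z0 <= rho -> Cmod z' <= rho ->
  Cmod (z' - z)%C <= d -> Cmod (h z' - h z)%C <= d * d / 8 ->
  lift_within rho z0 z g -> exists g', lift_within rho z0 z' g'.
Proof.
intros Hrho Hd Hch Hz0 Hz' Hzz Hhh [Hg Hgr].
set (c' := (h z' - h z0)%C).
(* The range condition sits under the existential so that choice yields a function on all of [R];
   [z0] is the default outside [[0, 1]]. *)
assert (Hex : forall t, exists w, 0 <= t <= 1 ->
  Cmod (w - g t)%C <= d /\ h w = (h z0 + RtoC t * c')%C).
{ intros t; destruct (classic (0 <= t <= 1)) as [Ht | Ht]; [|now exists z0].
  destruct (Hch (g t) (Hgr t Ht)) as [[A _] K].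
  destruct (newton_surjective h (g t) (h1 (g t)) (h z0 + RtoC t * c')%C d) as [w Hw].
  - exact Hd.
  - apply Cmod_gt_0; lra.
  - intros x y Hx Hy; apply K; lra.
  (* The target moves by [t (h z' - h z)], of modulus at most [d * d / 8 <= |h1 (g t)| * d / 8]. *)
  - rewrite (lift_eq _ _ _ _ Hg t Ht).
    replace (h z0 + RtoC t * c' - (h z0 + RtoC t * (h z - h z0)))%C
      with (RtoC t * (h z' - h z))%C by (unfold c'; ring).
    rewrite Cmod_mult, Cmod_R, Rabs_pos_eq by lra.
    pose proof (Cmod_ge_0 (h z' - h z)%C).
    apply Rle_trans with (Cmod (h z' - h z)%C); nra.
  - now exists w. }
pose (N := fun t => proj1_sig (constructive_indefinite_description _ (Hex t))).
assert (HN : forall t, 0 <= t <= 1 ->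
  Cmod (N t - g t)%C <= d /\ h (N t) = (h z0 + RtoC t * c')%C)
  by (intros t; exact (proj2_sig (constructive_indefinite_description _ (Hex t)))).
assert (Huniq : forall a x y, Cmod a <= rho ->
  Cmod (x - a)%C <= 3 * d -> Cmod (y - a)%C <= 3 * d -> h x = h y -> x = y).
{ intros a x y Ha Hx Hy E.
  pose proof (uniform_chart_inj a x y d Hd (Hch a Ha) Hx Hy) as B.
  rewrite E in B; replace (h y - h y)%C with (RtoC 0) in B by ring.
  rewrite Cmod_0 in B; pose proof (Cmod_ge_0 (x - y)%C).
  assert (Z : Cmod (x - y)%C = 0) by nra.
  apply Cmod_eq_0 in Z; replace x with (x - y + y)%C by ring; rewrite Z; ring. }
assert (Hlift : segment_lift h z0 z' (fun t => N (clamp t))).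
{ split.
  - intros t eps Heps.
    destruct (lift_cont _ _ _ _ Hg (clamp t) d Hd) as [e [He K]].
    pose proof (Cmod_ge_0 c') as Hc'.
    set (q := eps * (d / 2) / (Cmod c' + 1)).
    assert (Hq : 0 < q) by (unfold q; apply Rdiv_lt_0_compat; nra).
    exists (Rmin e q); split; [now apply Rmin_glb_lt|]; intros s Hs.
    pose proof (Rmin_l e q); pose proof (Rmin_r e q).
    pose proof (clamp_lipschitz s t) as Hl.
    specialize (K (clamp s) ltac:(lra)).
    pose proof (clamp_range s) as Rs; pose proof (clamp_range t) as Rt.
    destruct (HN _ Rs) as [A1 A2]; destruct (HN _ Rt) as [B1 B2].
    (* Both chosen points lie within [2 d] of [g (clamp t)], so the chart there compares them. *)
    pose proof (Cmod_sub_triangle (N (clamp s)) (g (clamp s)) (g (clamp t))) as T.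
    pose proof (uniform_chart_inj (g (clamp t)) (N (clamp s)) (N (clamp t)) d Hd
      (Hch _ (Hgr _ Rt)) ltac:(lra) ltac:(lra)) as I.
    rewrite A2, B2 in I.
    replace (h z0 + RtoC (clamp s) * c' - (h z0 + RtoC (clamp t) * c'))%C
      with (RtoC (clamp s - clamp t) * c')%C in I by (rewrite RtoC_minus; ring).
    rewrite Cmod_mult, Cmod_R in I.
    apply Rmult_lt_reg_l with (d / 2); [lra|].
    eapply Rle_lt_trans; [exact I|].
    apply Rle_lt_trans with (Rabs (s - t) * (Cmod c' + 1)).
    + apply Rmult_le_compat; try lra; apply Rabs_pos.
    + apply Rlt_le_trans with (q * (Cmod c' + 1)).
      * apply Rmult_lt_compat_r; lra.
      * right; unfold q; field; lra.
  - rewrite clamp_id by lra; destruct (HN 0 ltac:(lra)) as [A B].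
    rewrite (lift_start _ _ _ _ Hg) in A.
    apply (Huniq z0); trivial; try lra.
    + replace (z0 - z0)%C with (RtoC 0) by ring; rewrite Cmod_0; lra.
    + rewrite B; ring.
  - rewrite clamp_id by lra; destruct (HN 1 ltac:(lra)) as [A B].
    pose proof (Hgr 1 ltac:(lra)) as Hz1.
    rewrite (lift_end _ _ _ _ Hg) in A, Hz1.
    apply (Huniq z); trivial; try lra.
    rewrite B; unfold c'; ring.
  - intros t Ht; rewrite clamp_id by lra; destruct (HN t Ht) as [A _].
    destruct (Hch (g t) (Hgr t Ht)) as [_ K].
    apply (K (N t) (N t)); lra.
  - intros t Ht; rewrite clamp_id by lra; now destruct (HN t Ht). }
(* The a priori bound requires a nonzero increment; a zero one forces [z' = z0], and the constant
   path serves. *)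
destruct (classic (c' = RtoC 0)) as [Hc | Hc].
- exists (fun _ => z0); rewrite (lift_const z0 z' _ Hlift Hc).
  now apply lift_within_const.
- exists (fun t => N (clamp t)); split; [exact Hlift|].
  intros t Ht; now apply (lift_Cmod_le z0 z' _ Hlift).
Qed.

(** The end point travels from [z0] to [z1] along their segment in equal steps; the chart scale
    depends only on [rho], so finitely many steps suffice. *)
Lemma lift_exists (rho : R) (z0 z1 : C) :
  rho < 1 -> Cmod z0 <= rho -> Cmod z1 <= rho -> exists g, lift_within rho z0 z1 g.
Proof.
intros Hrho H0 H1.
destruct (uniform_chart_exists rho Hrho) as [d [Hd Hch]].
set (D := Cmod (z1 - z0)%C).
assert (HD : 0 <= D) by apply Cmod_ge_0.
(* A step [X <= e] changes [h] by at most [3 / 2 * |h1| X <= 3 / 2 * / d * (d * d * d / 12) = d * d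
   / 8], as [lift_step] demands. *)
set (e := Rmin d (d * d * d / 12)).
assert (Hd3 : 0 < d * d * d) by (repeat apply Rmult_lt_0_compat; exact Hd).
assert (He : 0 < e) by (unfold e; apply Rmin_glb_lt; lra).
destruct (nfloor_ex (D / e)) as [n [_ Hn]].
{ apply Rmult_le_pos; [exact HD | left; now apply Rinv_0_lt_compat]. }
set (M := S n).
assert (HM : 0 < INR M) by (apply lt_0_INR; unfold M; lia).
assert (HDe : D <= e * INR M).
{ unfold M; rewrite S_INR; apply Rmult_lt_compat_l with (r := e) in Hn; [|exact He].
  replace (e * (D / e)) with D in Hn by (field; lra); lra. }
set (p := fun j : nat => (z0 + RtoC (INR j / INR M) * (z1 - z0))%C).
assert (Hp : forall j, (j <= M)%nat -> Cmod (p j) <= rho).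
{ intros j Hj; apply le_INR in Hj; pose proof (pos_INR j).
  replace (p j) with (p j - RtoC 0)%C by ring.
  apply Cmod_segment_sub.
  - split.
    + apply Rmult_le_pos; [lra | left; now apply Rinv_0_lt_compat].
    + apply Rmult_le_reg_r with (INR M); [exact HM|].
      unfold Rdiv; rewrite Rmult_assoc, Rinv_l by lra; lra.
  - now replace (z1 - RtoC 0)%C with z1 by ring.
  - now replace (z0 - RtoC 0)%C with z0 by ring. }
assert (Hind : forall j, (j <= M)%nat -> exists g, lift_within rho z0 (p j) g).
{ induction j as [|j IH]; intros Hj.
  - exists (fun _ => z0).
    replace (p 0%nat) with z0.
    + now apply lift_within_const.
    + unfold p; simpl; unfold Rdiv; rewrite Rmult_0_l; ring.
  - destruct (IH ltac:(lia)) as [g Hg].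
    assert (Hstep : Cmod (p (S j) - p j)%C <= e).
    { replace (p (S j) - p j)%C with (RtoC (/ INR M) * (z1 - z0))%C.
      - rewrite Cmod_mult, Cmod_R, Rabs_pos_eq
          by (left; now apply Rinv_0_lt_compat).
        fold D; apply Rmult_le_reg_l with (INR M); [exact HM|].
        rewrite <- Rmult_assoc, Rinv_r by lra; lra.
      - unfold p.
        replace (INR (S j) / INR M) with (INR j / INR M + / INR M)
          by (rewrite S_INR; field; lra).
        rewrite RtoC_plus; ring. }
    assert (E1 : e <= d) by apply Rmin_l.
    assert (E2 : e <= d * d * d / 12) by apply Rmin_r.
    apply (lift_step rho d z0 (p j) (p (S j)) g); trivial.
    + now apply Hp.
    + lra.
    + destruct (Hch (p j) (Hp j ltac:(lia))) as [[A B] K].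
      destruct (K (p (S j)) (p j)) as [_ I]; [lra | |].
      { replace (p j - p j)%C with (RtoC 0) by ring; rewrite Cmod_0; lra. }
      pose proof (Cmod_le_add_sub (h (p (S j)) - h (p j)) (h1 (p j) * (p (S j) - p j)))
        as T.
      rewrite Cmod_mult in T.
      set (X := Cmod (p (S j) - p j)%C) in *.
      assert (0 <= X) by apply Cmod_ge_0.
      assert (Cmod (h1 (p j)) * X <= / d * (d * d * d / 12)).
      { apply Rmult_le_compat; try lra. }
      replace (/ d * (d * d * d / 12)) with (d * d / 12) in * by (field; lra).
      lra. }
destruct (Hind M (le_n M)) as [g Hg]; exists g.
replace z1 with (p M); [exact Hg|].
unfold p; replace (INR M / INR M) with 1 by (field; lra); ring.
Qed.

(** * Univalence on the unit disk and the radius *)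

Lemma u_of_univalent : univalent_on unit_disk (u_of h h1).
Proof.
intros z w Hz Hw E; unfold unit_disk, in_disk in *.
destruct (lift_exists (Rmax (Cmod z) (Cmod w)) z w) as [g [Hg _]].
- now apply Rmax_lub_lt.
- apply Rmax_l.
- apply Rmax_r.
- destruct (classic (h w - h z = RtoC 0)%C) as [Hc | Hc].
  + symmetry; exact (lift_const z w g Hg Hc).
  + exfalso; exact (u_of_separates z w g Hg Hc E).
Qed.

End Convex.

Lemma radius_r_le_1 (alpha : R) : 0 <= alpha -> alpha < 1 / 2 -> radius_r alpha <= 1.
Proof.
intros H0 H1; unfold radius_r.
(* After clearing [1 - 2 alpha], the claim is [sqrt (...) <= (1 - 2 alpha) + (1 - alpha)]; the
   squares differ by [2 (1 - 2 alpha)^2]. *)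
assert (S : sqrt ((1 - alpha) ^ 2 + 1 - 2 * alpha) <= 2 - 3 * alpha).
{ rewrite <- (sqrt_pow2 (2 - 3 * alpha)) by lra.
  apply sqrt_le_1_alt; nra. }
apply Rmult_le_reg_r with (1 - 2 * alpha); [lra|].
unfold Rdiv; rewrite Rmult_assoc, Rinv_l by lra; lra.
Qed.

Theorem theorem2 (alpha : R) (h h1 h2 : C -> C) :
  0 <= alpha < 1 ->
  normalized_analytic h h1 h2 ->
  convex_of_order alpha h1 h2 ->
  (1 / 2 <= alpha -> univalent_on unit_disk (u_of h h1)) /\
  (alpha < 1 / 2 -> univalent_on (in_disk (radius_r alpha)) (u_of h h1)).
Proof.
intros Ha (Dh & Dh1 & _ & _) (Hn & Hre).
assert (HU : univalent_on unit_disk (u_of h h1)).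
{ apply (u_of_univalent h h1 h2).
  - intros z Hz; now apply is_derive_Cderiv, Dh.
  - intros z Hz; now apply is_derive_Cderiv, Dh1.
  - exact Hn.
  (* Order [alpha >= 0] gives the plain convexity inequality with bound 0. *)
  - intros z Hz; specialize (Hre z Hz); lra. }
split; [trivial|]; intros Hlt z w Hz Hw.
pose proof (radius_r_le_1 alpha (proj1 Ha) Hlt).
apply HU; unfold unit_disk, in_disk in *; lra.
Qed.
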